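(* Let $\Sigma=(G,\sigma)$ be a signed graph whose underlying graph $G$ is finite, simple and connected. The following statements are equivalent: (i) $\Sigma$ is balanced. (ii) The associated signed complete graph $K^{D^{\max}}(\Sigma)$ is balanced. (iii) The associated signed complete graph $K^{D^{\min}}(\Sigma)$ is balanced. (iv) $D^{\max}(\Sigma)=D^{\min}(\Sigma)$ and the associated signed complete graph $K^{D^{\pm}}(\Sigma)$ is balanced.
   Context: A signed graph $\Sigma=(G,\sigma)$ consists of an underlying graph $G=(V,E)$ and a signature $\sigma:E\to\{1,-1\}$. The sign of a path or cycle is the product of the signs of its edges. $\Sigma$ is balanced if every cycle of $\Sigma$ has sign $+1$. Let $d(u,v)$ be the usual graph distance in $G$. For vertices $u,v$, let $\sigma_{\max}(u,v)=-1$ if all shortest $uv$-paths have sign $-1$, and $\sigma_{\max}(u,v)=+1$ otherwise; let $\sigma_{\min}(u,v)=+1$ if all shortest $uv$-paths have sign $+1$, and $\sigma_{\min}(u,v)=-1$ otherwise. Put $d_{\max}(u,v)=\sigma_{\max}(u,v)\,d(u,v)$ and $d_{\min}(u,v)=\sigma_{\min}(u,v)\,d(u,v)$. The signed distance matrices are the $V\times V$ matrices $D^{\max}(\Sigma)=(d_{\max}(u,v))$ and $D^{\min}(\Sigma)=(d_{\min}(u,v))$. The associated signed complete graph $K^{D^{\max}}(\Sigma)$ (respectively $K^{D^{\min}}(\Sigma)$) is the signed complete graph on $V$ obtained from $\Sigma$ by keeping every edge of $\Sigma$ with its sign and joining each pair of distinct non-adjacent vertices $u,v$ by an edge of sign $\sigma_{\max}(u,v)$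 (respectively $\sigma_{\min}(u,v)$). If $D^{\max}(\Sigma)=D^{\min}(\Sigma)$, these two signed complete graphs coincide and are denoted $K^{D^{\pm}}(\Sigma)$. *)

(* Defs.v *)
From mathcomp Require Import all_boot all_order all_algebra.

Set Implicit Arguments.
Unset Strict Implicit.
Unset Printing Implicit Defensive.

Import GRing.Theory Num.Theory.
Local Open Scope ring_scope.

(* The edges are the unordered pairs {u, v} with adj u v. Only the values of
   sgn on adjacent pairs are meaningful: they are the signature on E. *)
Record signed_graph (V : finType) := SignedGraph {
  adj : rel V;
  sgn : V -> V -> int;
  adj_sym : symmetric adj;
  adj_irr : irreflexive adj;
  sgn_sym : forall u v, adj u v -> sgn u v = sgn v u;
  sgn_pm1 : forall u v, adj u v -> sgn u v = 1 \/ sgn u v = -1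
}.

Section SignedGraphs.
Variables (V : finType) (S : signed_graph V).
Implicit Types (u v : V) (p c : seq V).

Definition connected := forall u v, connect (adj S) u v.

(* A path is given by its first vertex u and the sequence p of the following
   vertices, so that its length is size p. *)
Definition uvpath u v p := [&& path (adj S) u p, uniq (u :: p) & last u p == v].

Definition path_sign u p : int := \prod_(a <- pairmap (sgn S) u p) a.

Definition is_cycle c := ucycleb (adj S) c && (2 < size c)%N.

Definition cycle_sign c : int :=
  if c is x :: p then path_sign x (rcons p x) else 1.

Definition balanced := forall c, is_cycle c -> cycle_sign c = 1.

(* A path has length less than #|V|; the value is #|V| if there is no path
   from u to v, which does not happen in a connected graph. *)
Definition dist u v : nat :=
  find (fun n => [exists p : n.-tuple V, uvpath u v p]) (iota 0 #|V|).

Definition sigma_max u v : int :=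
  if [forall p : (dist u v).-tuple V, uvpath u v p ==> (path_sign u p == -1)]
  then -1 else 1.

Definition sigma_min u v : int :=
  if [forall p : (dist u v).-tuple V, uvpath u v p ==> (path_sign u p == 1)]
  then 1 else -1.

Definition d_max u v : int := sigma_max u v * (dist u v)%:R.
Definition d_min u v : int := sigma_min u v * (dist u v)%:R.

(* The V x V matrices, with V enumerated by enum_val. *)
Definition Dmax : 'M[int]_#|V| := \matrix_(i, j) d_max (enum_val i) (enum_val j).
Definition Dmin : 'M[int]_#|V| := \matrix_(i, j) d_min (enum_val i) (enum_val j).

Definition complete_adj : rel V := fun u v => u != v.

Definition complete_sgn (s : V -> V -> int) u v : int :=
  if adj S u v then sgn S u v else s u v.

Lemma uvpath_rev u v p :
  uvpath u v p -> uvpath v u (rev (belast u p)).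
Proof.
case/and3P => Hp Hu /eqP <-; apply/and3P; split.
- by rewrite rev_path (eq_path (e' := adj S)) // => x y; rewrite adj_sym.
- by rewrite -rev_rcons -lastI rev_uniq.
- by case: p {Hp Hu} => //= y p; rewrite rev_cons last_rcons.
Qed.

Lemma path_sign_cat u p q :
  path_sign u (p ++ q) = path_sign u p * path_sign (last u p) q.
Proof. by rewrite /path_sign pairmap_cat big_cat. Qed.

Lemma path_sign_rev u p : path (adj S) u p ->
  path_sign (last u p) (rev (belast u p)) = path_sign u p.
Proof.
elim: p u => [|y p IH] u //= /andP[Huy Hp].
rewrite rev_cons -cats1 path_sign_cat IH //.
have -> : last (last y p) (rev (belast y p)) = y.
  by case: p {IH Hp} => //= z p; rewrite rev_cons last_rcons.
rewrite {2 3}/path_sign /= !big_cons big_nil mulr1 mulrC.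
by rewrite (sgn_sym (s := S)) // adj_sym.
Qed.

Lemma dist_sym u v : dist u v = dist v u.
Proof.
apply: eq_find => n.
apply/existsP/existsP => -[p Hp].
- by exists (rev_tuple (belast_tuple u p)); exact: uvpath_rev.
- by exists (rev_tuple (belast_tuple v p)); exact: uvpath_rev.
Qed.

Lemma all_paths_sym n (a : int) u v :
  [forall p : n.-tuple V, uvpath u v p ==> (path_sign u p == a)] =
  [forall p : n.-tuple V, uvpath v u p ==> (path_sign v p == a)].
Proof.
wlog suff H : u v / [forall p : n.-tuple V, uvpath u v p ==> (path_sign u p == a)]
  -> [forall p : n.-tuple V, uvpath v u p ==> (path_sign v p == a)].
  by apply/idP/idP; exact: H.
move=> /forallP H; apply/forallP => p; apply/implyP => Hp.
have := H (rev_tuple (belast_tuple v p)).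
rewrite (uvpath_rev Hp) /= => /eqP <-.
by case/and3P: Hp => Hp _ /eqP Hl; rewrite -[in path_sign u _]Hl path_sign_rev.
Qed.

Lemma sigma_max_sym u v : sigma_max u v = sigma_max v u.
Proof. by rewrite /sigma_max dist_sym all_paths_sym. Qed.

Lemma sigma_min_sym u v : sigma_min u v = sigma_min v u.
Proof. by rewrite /sigma_min dist_sym all_paths_sym. Qed.

Lemma sigma_max_pm1 u v : sigma_max u v = 1 \/ sigma_max u v = -1.
Proof. by rewrite /sigma_max; case: ifP; [right | left]. Qed.

Lemma sigma_min_pm1 u v : sigma_min u v = 1 \/ sigma_min u v = -1.
Proof. by rewrite /sigma_min; case: ifP; [left | right]. Qed.

Lemma complete_adj_sym : symmetric complete_adj.
Proof. by move=> u v; rewrite /complete_adj eq_sym. Qed.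

Lemma complete_adj_irr : irreflexive complete_adj.
Proof. by move=> u; rewrite /complete_adj eqxx. Qed.

Lemma complete_sgn_sym (s : V -> V -> int) :
  (forall u v, s u v = s v u) ->
  forall u v, complete_adj u v -> complete_sgn s u v = complete_sgn s v u.
Proof.
move=> Hs u v _; rewrite /complete_sgn adj_sym; case: ifP => // H.
by rewrite (sgn_sym (s := S)) // adj_sym.
Qed.

Lemma complete_sgn_pm1 (s : V -> V -> int) :
  (forall u v, s u v = 1 \/ s u v = -1) ->
  forall u v, complete_adj u v ->
  complete_sgn s u v = 1 \/ complete_sgn s u v = -1.
Proof. by move=> Hs u v _; rewrite /complete_sgn; case: ifP => // /sgn_pm1. Qed.

Definition KDmax : signed_graph V :=
  SignedGraph complete_adj_sym complete_adj_irr
    (complete_sgn_sym sigma_max_sym) (complete_sgn_pm1 sigma_max_pm1).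

Definition KDmin : signed_graph V :=
  SignedGraph complete_adj_sym complete_adj_irr
    (complete_sgn_sym sigma_min_sym) (complete_sgn_pm1 sigma_min_pm1).

Lemma dist_neq0 u v : u != v -> dist u v != 0%N.
Proof.
move=> Huv; rewrite /dist; have : (0 < #|V|)%N by apply/card_gt0P; exists u.
case: #|V| => //= m _; case: ifP => // /existsP[p].
by rewrite (tuple0 p) /uvpath /= (negPf Huv).
Qed.

Lemma KDmax_KDmin : Dmax = Dmin ->
  forall u v, adj KDmax u v -> sgn KDmax u v = sgn KDmin u v.
Proof.
move=> E u v Huv; rewrite /= /complete_sgn; case: ifP => // _.
have := congr1 (fun M : 'M_#|V| => M (enum_rank u) (enum_rank v)) E.
rewrite !mxE !enum_rankK /d_max /d_min => /mulIf; apply.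
by rewrite pnatr_eq0 dist_neq0.
Qed.

(* The common value of KDmax and KDmin (see KDmax_KDmin), which is defined
   only when Dmax = Dmin. *)
Definition KDpm (_ : Dmax = Dmin) : signed_graph V := KDmax.

End SignedGraphs.

(* Main.v *)
Require Import Defs.
From mathcomp Require Import all_boot all_order all_algebra.

(** Everything passes through Harary's criterion: a connected signed graph is
    balanced iff its signature is a coboundary, that is, iff there is a function
    [f : V -> {1, -1}] with [sgn u v = f u * f v] on every edge. One direction
    is telescoping: along a walk from [u] to [v] the product of the signs is
    [f u * f v], hence is 1 on a cycle. For the other, every closed walk of a
    balanced graph has sign 1 ([balanced_closed_walk]), so that the sign of a
    walk from a fixed root to [v] depends on [v] only, and serves as [f v].

    If [f] is such a function for [S], then all the paths from [u] to [v],
    in particular the shortest ones, have the same sign [f u * f v]. Hence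
    [sigma_max] and [sigma_min] both equal [f u * f v]: the two distance
    matrices agree, and [f] exhibits the signatures of both complete graphs as
    coboundaries, so that these graphs are balanced. Conversely [S] is a
    signed subgraph of either complete graph, and inherits balance from it. *)

Set Implicit Arguments.
Unset Strict Implicit.
Unset Printing Implicit Defensive.

Import GRing.Theory Num.Theory.
Local Open Scope ring_scope.

Lemma repeated_split (T : eqType) (p : seq T) : ~~ uniq p ->
  exists y a b c, p = rcons a y ++ rcons b y ++ c.
Proof.
elim: p => //= z p IH; rewrite negb_and negbK => /orP[/splitPr[b c]|/IH].
  by exists z, [::], b, c; rewrite !cat_rcons.
by case=> y [a [b [c ->]]]; exists y, (z :: a), b, c.
Qed.

Section Balance.
Variables (V : finType) (S : signed_graph V).

(** Switching [S] at the vertices where [f] is -1 makes every edge positive. *)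
Definition switching (f : V -> int) :=
  (forall u, f u = 1 \/ f u = -1) /\
  (forall u v, adj S u v -> sgn S u v = f u * f v).

Lemma path_sign1 u v : path_sign S u [:: v] = sgn S u v.
Proof. by rewrite /path_sign /= big_seq1. Qed.

Lemma switching_sqr f u : switching f -> f u * f u = 1.
Proof. by case=> f1 _; case: (f1 u) => ->. Qed.

Lemma switching_path_sign f u p : switching f -> path (adj S) u p ->
  path_sign S u p = f u * f (last u p).
Proof.
move=> sw; elim: p u => [|v p IH] u /=.
  by rewrite /path_sign big_nil switching_sqr.
case/andP=> uv vp; rewrite -cat1s path_sign_cat path_sign1 /= IH //.
by rewrite sw.2 // -mulrA [f v * (_ * _)]mulrA switching_sqr // mul1r.
Qed.

Lemma switching_balanced f : switching f -> balanced S.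
Proof.
move=> sw [|x p] //= /andP[/andP[cyc _] _].
by rewrite (switching_path_sign sw) // last_rcons switching_sqr.
Qed.

(** A closed walk that visits some vertex twice splits there into two shorter
    closed walks; one that does not is a cycle, or goes to and fro along a
    single edge, or is trivial. *)
Lemma balanced_closed_walk x p : balanced S ->
  path (adj S) x p -> last x p = x -> path_sign S x p = 1.
Proof.
move=> bal; have [n] := ubnP (size p).
elim: n x p => // n IH x p ltpn xp lastp.
have [up|] := boolP (uniq p); last first.
  case/repeated_split=> y [a [b [c def_p]]]; subst p.
  move: xp lastp; rewrite !cat_path !last_cat !last_rcons => /and3P[xa yb yc] lastc.
  rewrite !size_cat !size_rcons in ltpn.
  rewrite !path_sign_cat !last_rcons (IH y (rcons b y)) ?last_rcons //; last first.
    rewrite size_rcons; move: ltpn; rewrite ltnS; apply: leq_trans.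
    by rewrite addSn ltnS addnCA leq_addr.
  rewrite mul1r -[X in path_sign _ X c](last_rcons x a) -path_sign_cat IH //.
  - move: ltpn; rewrite size_cat size_rcons ltnS; apply: leq_trans.
    by rewrite ltn_add2l addSn ltnS leq_addl.
  - by rewrite cat_path xa last_rcons.
  - by rewrite last_cat last_rcons.
case/lastP: p => [|p z] in ltpn xp lastp up *; first by rewrite /path_sign big_nil.
rewrite last_rcons in lastp; subst z.
case: p => [|y [|z p]] in ltpn xp up *.
- by move: xp; rewrite /= adj_irr.
- move: xp => /= /and3P[xy yx _].
  rewrite -cat1s path_sign_cat !path_sign1 /= (sgn_sym yx).
  by case: (sgn_pm1 xy) => ->.
- apply: (bal (x :: y :: z :: p)).
  by rewrite /is_cycle /ucycleb /cycle xp andbT; rewrite rcons_uniq in up.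
Qed.

Hypothesis conS : connected S.

(** With [f v] the sign of some walk from a root to [v], an edge [u v] and the
    walks chosen for its ends close up into a walk, which has sign 1. *)
Lemma balanced_switching : balanced S -> exists f, switching f.
Proof.
move=> bal; have [r _|V0] := pickP V; last first.
  by exists (fun=> 1); split=> [|u]; [left | have := V0 u].
have walk v : {w | path (adj S) r w & v == last r w}.
  by apply: sig2W; have /connectP[w rw ->] := conS r v; exists w.
pose f v := path_sign S r (s2val (walk v)).
have pm1 u p : path (adj S) u p -> path_sign S u p = 1 \/ path_sign S u p = -1.
  elim: p u => [|v p IH] u /=; first by left; rewrite /path_sign big_nil.
  case/andP=> uv vp; rewrite -cat1s path_sign_cat path_sign1 /=.
  by case: (sgn_pm1 uv) => ->; case: (IH v vp) => ->; auto.
have f_pm1 u : f u = 1 \/ f u = -1 by exact: (pm1 r _ (s2valP (walk u))).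
exists f; split=> // u v uv.
have : f u * (sgn S u v * f v) = 1.
  rewrite /f; case: (walk u) (walk v) => [p rp /eqP lp] [q rq /eqP lq] /=.
  rewrite -(path_sign_rev rq) -path_sign1 -lq.
  rewrite -[X in path_sign S X (rev _)]/(last u [:: v]) -path_sign_cat {1}lp.
  rewrite -path_sign_cat; apply: balanced_closed_walk => //.
    rewrite cat_path rp -lp /= uv lq rev_path.
    by rewrite (eq_path (e' := adj S)) // => x y; rewrite adj_sym.
  rewrite last_cat /= lq; case: (q) => //= y s.
  by rewrite rev_cons last_rcons.
by case: (f_pm1 u) (f_pm1 v) (sgn_pm1 uv) => -> [] -> [] ->.
Qed.

(** The search range of [dist] suffices since a path repeats no vertex. *)
Lemma shortest_uvpath u v : exists p : (dist S u v).-tuple V, uvpath S u v p.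
Proof.
apply/existsP; rewrite /dist; set a := fun n => _.
have hasa : has a (iota 0 #|V|).
  have /connectP[w /shortenP[p up Up _] def_v] := conS u v.
  apply/hasP; exists (size p); last first.
    by apply/existsP; exists (in_tuple p); apply/and3P; split=> //; apply/eqP.
  by rewrite mem_iota add0n -[(size p).+1]/(size (u :: p)) -(card_uniqP Up)
     max_card.
have := nth_find 0%N hasa; rewrite nth_iota //.
by rewrite -[X in (_ < X)%N](size_iota 0) -has_find.
Qed.

Lemma switching_uvpath_sign f u v p : switching f -> uvpath S u v p ->
  path_sign S u p = f u * f v.
Proof.
by move=> sw /and3P[up _ /eqP <-]; exact: switching_path_sign.
Qed.

Lemma switching_prod_pm1 f u v : switching f ->
  f u * f v = 1 \/ f u * f v = -1.
Proof. by case=> f1 _; case: (f1 u) (f1 v) => -> [] ->; auto. Qed.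

(** All the paths from [u] to [v] have the sign [f u * f v], and at least one
    of them is shortest, so that the quantification is not vacuous. *)
Lemma switching_all_paths f u v a : switching f ->
  [forall p : (dist S u v).-tuple V, uvpath S u v p ==> (path_sign S u p == a)]
  = (f u * f v == a).
Proof.
move=> sw; apply/forallP/idP => [all_a | fa p].
  have [p uvp] := shortest_uvpath u v.
  by have := all_a p; rewrite uvp (switching_uvpath_sign sw uvp).
by apply/implyP=> uvp; rewrite (switching_uvpath_sign sw uvp).
Qed.

Lemma switching_sigma_max f u v : switching f -> sigma_max S u v = f u * f v.
Proof.
move=> sw; rewrite /sigma_max (switching_all_paths _ _ _ sw).
by case: (switching_prod_pm1 u v sw) => ->.
Qed.

Lemma switching_sigma_min f u v : switching f -> sigma_min S u v = f u * f v.
Proof.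
move=> sw; rewrite /sigma_min (switching_all_paths _ _ _ sw).
by case: (switching_prod_pm1 u v sw) => ->.
Qed.

End Balance.

Lemma switching_KDmax (V : finType) (S : signed_graph V) f :
  connected S -> switching S f -> switching (KDmax S) f.
Proof.
move=> conS sw; split=> [|u v _ /=]; first exact: sw.1.
by rewrite /complete_sgn; case: ifP => [/sw.2|_] //; exact: switching_sigma_max.
Qed.

Lemma switching_KDmin (V : finType) (S : signed_graph V) f :
  connected S -> switching S f -> switching (KDmin S) f.
Proof.
move=> conS sw; split=> [|u v _ /=]; first exact: sw.1.
by rewrite /complete_sgn; case: ifP => [/sw.2|_] //; exact: switching_sigma_min.
Qed.

Lemma balanced_subgraph (V : finType) (S T : signed_graph V) :
    (forall u v, adj S u v -> adj T u v /\ sgn T u v = sgn S u v) ->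
  balanced T -> balanced S.
Proof.
move=> sub bal [|x p] //= /andP[/andP[cyc Uc] sz].
have subST : subrel (adj S) (adj T) by move=> u v /sub[].
have sign u q : path (adj S) u q -> path_sign S u q = path_sign T u q.
  elim: q u => [|v q IH] u /=; first by rewrite /path_sign !big_nil.
  case/andP=> uv vq; rewrite -cat1s !path_sign_cat !path_sign1 /= IH //.
  by have [_ ->] := sub _ _ uv.
rewrite sign //; apply: (bal (x :: p)); rewrite /is_cycle /ucycleb Uc sz !andbT.
exact: (sub_path subST) cyc.
Qed.

Lemma complete_subgraph (V : finType) (S : signed_graph V) s u v :
  adj S u v -> complete_adj u v /\ complete_sgn S s u v = sgn S u v.
Proof.
move=> uv; rewrite /complete_sgn uv; split=> //.
by apply: contraTneq uv => ->; rewrite adj_irr.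
Qed.

Lemma balanced_KDmax (V : finType) (S : signed_graph V) :
  balanced (KDmax S) -> balanced S.
Proof. by apply: balanced_subgraph => u v; exact: complete_subgraph. Qed.

Lemma balanced_KDmin (V : finType) (S : signed_graph V) :
  balanced (KDmin S) -> balanced S.
Proof. by apply: balanced_subgraph => u v; exact: complete_subgraph. Qed.

Theorem theorem3p1 (V : finType) (S : signed_graph V) (hS : connected S) :
  [<-> balanced S;
       balanced (KDmax S);
       balanced (KDmin S);
       exists E : Dmax S = Dmin S, balanced (KDpm E)].
Proof.
tfae.
- case/(balanced_switching hS)=> f sw.
  exact: switching_balanced (switching_KDmax hS sw).
- case/balanced_KDmax/(balanced_switching hS)=> f sw.
  exact: switching_balanced (switching_KDmin hS sw).
- case/balanced_KDmin/(balanced_switching hS)=> f sw.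
  have E : Dmax S = Dmin S.
    apply/matrixP=> i j; rewrite !mxE /d_max /d_min.
    by rewrite (switching_sigma_max hS _ _ sw) (switching_sigma_min hS _ _ sw).
  by exists E; exact: switching_balanced (switching_KDmax hS sw).
- by case=> E; exact: balanced_KDmax.
Qed.
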